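(* For all $\alpha,\beta\in\mathrm{ASP}$, $\alpha\star\beta\ge\alpha\beta$ in Bruhat order, and $\alpha\star\beta=\alpha\beta$ if and only if $\mathrm{Inv}(\alpha)\cap\mathrm{Inv}(\beta^{-1})=\emptyset$.
   Context: A permutation means a bijection $\mathbb{Z}\to\mathbb{Z}$; products of permutations are compositions. $\mathrm{ASP}$ is the group of permutations $\alpha$ for which only finitely many $n\in\mathbb{Z}$ have exactly one of $n,\alpha(n)$ negative. For $\alpha\in\mathrm{ASP}$, $s_\alpha(a,b)=\#\{n\ge b:\ \alpha(n)<a\}$ for $a,b\in\mathbb{Z}$ (always finite; $s_\alpha$ determines $\alpha$). Bruhat order on $\mathrm{ASP}$: $\alpha\le\beta$ means $s_\alpha(a,b)\le s_\beta(a,b)$ for all $a,b\in\mathbb{Z}$. The Demazure product $\alpha\star\beta$ is the unique element of $\mathrm{ASP}$ such that $s_{\alpha\star\beta}(a,b)=\min_{\ell\in\mathbb{Z}}[s_\alpha(a,\ell)+s_\beta(\ell,b)]$ for all $a,b\in\mathbb{Z}$ (such an element always exists). $\mathrm{Inv}(\alpha)=\{(u,v)\in\mathbb{Z}^2:\ u<v,\ \alpha(u)>\alpha(v)\}$. *)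

(* Defs.v *)
From HB Require Import structures.
From mathcomp Require Import all_boot all_order all_algebra finmap zify.
From mathcomp Require Import mathcomp_extra boolp classical_sets functions cardinality.

Set Implicit Arguments.
Unset Strict Implicit.
Unset Printing Implicit Defensive.

Import Order.TTheory GRing.Theory Num.Theory.
Local Open Scope classical_set_scope.
Local Open Scope ring_scope.

Record ASP := MkASP {
  asp_fun :> int -> int;
  asp_bij : bijective asp_fun;
  asp_fin : finite_set [set n : int | (n < 0) != (asp_fun n < 0)]
}.

Lemma aspP (alpha beta : ASP) : alpha =1 beta -> alpha = beta.
Proof.
case: alpha beta => [f fb ff] [g gb gf] /= /funext fg; subst g.
by rewrite (Prop_irrelevance fb gb) (Prop_irrelevance ff gf).
Qed.

Lemma bij_ex_inv (f : int -> int) : bijective f ->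
  exists g : int -> int, cancel f g /\ cancel g f.
Proof. by case=> g fK gK; exists g. Qed.

Definition asp_invfun (alpha : ASP) : int -> int :=
  sval (cid (bij_ex_inv (asp_bij alpha))).

Lemma asp_funK (alpha : ASP) : cancel alpha (asp_invfun alpha).
Proof. by rewrite /asp_invfun; case: cid => g []. Qed.

Lemma asp_invfunK (alpha : ASP) : cancel (asp_invfun alpha) alpha.
Proof. by rewrite /asp_invfun; case: cid => g []. Qed.

Lemma asp_inv_bij (alpha : ASP) : bijective (asp_invfun alpha).
Proof. by exists alpha; [exact: asp_invfunK | exact: asp_funK]. Qed.

Lemma asp_inv_fin (alpha : ASP) :
  finite_set [set n : int | (n < 0) != (asp_invfun alpha n < 0)].
Proof.
apply: (@sub_finite_set int _
  (alpha @` [set n : int | (n < 0) != (alpha n < 0)])).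
  move=> n /= h; exists (asp_invfun alpha n); last by rewrite asp_invfunK.
  by rewrite /= asp_invfunK eq_sym.
exact: finite_image (asp_fin alpha).
Qed.

Definition asp_inv (alpha : ASP) : ASP :=
  MkASP (asp_inv_bij alpha) (asp_inv_fin alpha).

Lemma asp_one_fin :
  finite_set [set n : int | (n < 0) != ((id : int -> int) n < 0)].
Proof.
by rewrite (_ : [set _ | _] = set0) ?seteqP//; split=> n //=; rewrite eqxx.
Qed.

Definition asp_one : ASP := MkASP (Bijective (frefl id) (frefl id)) asp_one_fin.

Lemma asp_mul_fin (alpha beta : ASP) :
  finite_set [set n : int | (n < 0) != ((alpha \o beta) n < 0)].
Proof.
apply: (@sub_finite_set int _
  ([set n : int | (n < 0) != (beta n < 0)] `|`
   asp_invfun beta @` [set n : int | (n < 0) != (alpha n < 0)])).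
  move=> n /= h; have [e|] := eqVneq (n < 0) (beta n < 0); last by left.
  by right; exists (beta n); rewrite ?asp_funK //= -e.
rewrite finite_setU; split; first exact: asp_fin.
exact: finite_image (asp_fin alpha).
Qed.

(* The product is [alpha \o beta]: unlike in [{perm T}], the right factor acts
   first. *)
Definition asp_mul (alpha beta : ASP) : ASP :=
  MkASP (bij_comp (asp_bij alpha) (asp_bij beta)) (asp_mul_fin alpha beta).

Lemma asp_mulA : associative asp_mul.
Proof. by move=> a b c; apply: aspP. Qed.

Lemma asp_mul1 : left_id asp_one asp_mul.
Proof. by move=> a; apply: aspP. Qed.

Lemma asp_mulr1 : right_id asp_one asp_mul.
Proof. by move=> a; apply: aspP. Qed.

Lemma asp_mulV : left_inverse asp_one asp_inv asp_mul.
Proof. by move=> a; apply: aspP => n /=; rewrite asp_funK. Qed.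

Lemma asp_mulrV : right_inverse asp_one asp_inv asp_mul.
Proof. by move=> a; apply: aspP => n /=; rewrite asp_invfunK. Qed.

HB.instance Definition _ := gen_eqMixin ASP.
HB.instance Definition _ := gen_choiceMixin ASP.
HB.instance Definition _ :=
  isGroup.Build ASP asp_mulA asp_mul1 asp_mulr1 asp_mulV asp_mulrV.

(* [fset_set] sends infinite sets to [fset0]; this set is always finite, see
   [finite_asp_set] below. *)
Definition asp_s (alpha : ASP) (a b : int) : nat :=
  #|` fset_set [set n : int | b <= n /\ alpha n < a]|.

Definition bruhat_le (alpha beta : ASP) : Prop :=
  forall a b : int, (asp_s alpha a b <= asp_s beta a b)%N.

Definition Inv (alpha : ASP) : set (int * int) :=
  [set p | p.1 < p.2 /\ alpha p.2 < alpha p.1].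

Lemma finite_int_range (a b : int) : finite_set [set n : int | a <= n /\ n < b].
Proof.
apply: (@sub_finite_set int _ ((fun k : nat => a + k%:Z) @` `I_(absz (b - a)))).
  by move=> n /= [h1 h2]; exists (absz (n - a)); lia.
exact: finite_image (finite_II _).
Qed.

Lemma finite_int_bound (A : set int) : finite_set A ->
  exists N : nat, forall n, A n -> (absz n < N)%N.
Proof.
move=> fA; exists (\max_(n <- fset_set A) absz n).+1 => n An.
by rewrite ltnS leq_bigmax_seq // in_fset_set // inE.
Qed.

Lemma finite_asp_set (alpha : ASP) (a b : int) :
  finite_set [set n : int | b <= n /\ alpha n < a].
Proof.
apply: (@sub_finite_set int _
  ([set n : int | (n < 0) != (alpha n < 0)] `|`
   ([set n : int | b <= n /\ n < 0] `|`
    asp_invfun alpha @` [set n : int | 0 <= n /\ n < a]))).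
  move=> n /= [h1 h2].
  have [n0|n0] := ltP n 0; first by right; left.
  have [m0|m0] := ltP (alpha n) 0; first by left.
  by right; right; exists (alpha n); rewrite ?asp_funK.
rewrite !finite_setU; split; first exact: asp_fin.
split; first exact: finite_int_range.
by apply: finite_image; exact: finite_int_range.
Qed.

Lemma asp_s_stepr (alpha : ASP) (a b : int) :
  asp_s alpha a b = (asp_s alpha a (b + 1)%R + (alpha b < a)%R)%N.
Proof.
rewrite /asp_s; case: (boolP (alpha b < a)) => h; last first.
  rewrite addn0; congr (#|` fset_set _|); apply/seteqP.
  split=> n /= [h1 h2]; split=> //; last by lia.
  have : n != b by apply: contraNneq h => <-.
  by lia.
have -> : [set n : int | b <= n /\ alpha n < a] =
  b |` [set n : int | b + 1 <= n /\ alpha n < a].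
  apply/seteqP; split=> n /=.
    by move=> [h1 h2]; have [->|nb] := eqVneq n b; [left | right; split=> //; lia].
  by case=> [->|[h1 h2]]; split=> //; lia.
rewrite fset_setU1 ?cardfsU1; last exact: finite_asp_set.
rewrite in_fset_set; last exact: finite_asp_set.
by rewrite addnC; congr (_ + nat_of_bool _)%N; apply/negP; rewrite inE /=; lia.
Qed.

Lemma asp_s_stepl (alpha : ASP) (a b : int) :
  asp_s alpha (a + 1)%R b = (asp_s alpha a b + (b <= asp_invfun alpha a)%R)%N.
Proof.
set c := asp_invfun alpha a.
have alc : alpha c = a by rewrite asp_invfunK.
have cE n : alpha n = a -> n = c by rewrite -alc => /(bij_inj (asp_bij alpha)).
rewrite /asp_s; case: (boolP (b <= c)) => h; last first.
  rewrite addn0; congr (#|` fset_set _|); apply/seteqP.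
  split=> n /= [h1 h2]; split=> //; last by lia.
  have : alpha n != a by apply: contraNneq h => /cE <-.
  by lia.
have -> : [set n : int | b <= n /\ alpha n < a + 1] =
  c |` [set n : int | b <= n /\ alpha n < a].
  apply/seteqP; split=> n /=.
    move=> [h1 h2]; have [/cE ->|nb] := eqVneq (alpha n) a; first by left.
    by right; split=> //; lia.
  by case=> [->|[h1 h2]]; split=> //; lia.
rewrite fset_setU1 ?cardfsU1; last exact: finite_asp_set.
rewrite in_fset_set; last exact: finite_asp_set.
rewrite addnC; congr (_ + nat_of_bool _)%N; apply/negP; rewrite inE /=; lia.
Qed.

Lemma asp_s_eq0 (alpha : ASP) (a b : int) :
  (forall n : int, b <= n -> a <= alpha n) -> asp_s alpha a b = 0%N.
Proof.
move=> h; rewrite /asp_s (_ : [set _ | _] = set0) ?fset_set0 ?cardfs0 //.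
by apply/seteqP; split=> n //= [/h]; lia.
Qed.

Lemma asp_s_vanr (alpha : ASP) (a : int) :
  exists B : int, forall b, B <= b -> asp_s alpha a b = 0%N.
Proof.
have [N hN] := finite_int_bound (finite_asp_set alpha a 0).
exists N%:Z => b hb; apply: asp_s_eq0 => n hn.
rewrite leNgt; apply/negP => h.
by have /hN : [set n : int | 0 <= n /\ alpha n < a] n; [split=> //; lia | lia].
Qed.

Lemma asp_s_vanl (alpha : ASP) (b : int) :
  exists A : int, forall a, a <= A -> asp_s alpha a b = 0%N.
Proof.
have [N hN] := finite_int_bound (finite_image alpha (finite_asp_set alpha 0 b)).
exists (- N%:Z) => a ha; apply: asp_s_eq0 => n hn.
rewrite leNgt; apply/negP => h.
have /hN : (alpha @` [set n : int | b <= n /\ alpha n < 0]) (alpha n).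
  by exists n => //; split=> //; lia.
by lia.
Qed.

Lemma asp_s_monor (alpha : ASP) (a b c : int) :
  b <= c -> (asp_s alpha a c <= asp_s alpha a b)%N.
Proof.
move=> bc; rewrite (_ : c = b + (absz (c - b))%:Z); last by lia.
elim: (absz _) => [|k IH]; first by rewrite addr0.
have := asp_s_stepr alpha a (b + k%:Z).
by rewrite (_ : b + k%:Z + 1 = b + k.+1%:Z); lia.
Qed.

Lemma asp_flip_bij (alpha : ASP) : bijective (fun n : int => - 1 - alpha (- 1 - n)).
Proof.
have e (m : int) : - 1 - (- 1 - m) = m by lia.
by exists (fun n : int => - 1 - asp_invfun alpha (- 1 - n)) => n;
  rewrite !e ?asp_funK ?asp_invfunK e.
Qed.

Lemma asp_flip_fin (alpha : ASP) :
  finite_set [set n : int | (n < 0) != (- 1 - alpha (- 1 - n) < 0)].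
Proof.
apply: (@sub_finite_set int _ ((fun n : int => - 1 - n) @`
   [set n : int | (n < 0) != (alpha n < 0)])).
  by move=> n /= h; exists (- 1 - n); [move: h; rewrite /= !negb_eqb; lia | lia].
exact: finite_image (asp_fin alpha).
Qed.

Definition asp_flip (alpha : ASP) : ASP :=
  MkASP (asp_flip_bij alpha) (asp_flip_fin alpha).

Lemma asp_flipV (alpha : ASP) (n : int) :
  asp_invfun (asp_flip alpha) n = - 1 - asp_invfun alpha (- 1 - n).
Proof.
apply: (bij_inj (asp_bij (asp_flip alpha))); rewrite asp_invfunK /=.
rewrite (_ : - 1 - (- 1 - asp_invfun alpha (- 1 - n)) =
             asp_invfun alpha (- 1 - n)); last by lia.
by rewrite asp_invfunK; lia.
Qed.

(* [asp_s (asp_flip alpha) (- a) (- b)] is the number of [n < b] with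
   [a <= alpha n]. *)
Lemma asp_s_flip (alpha : ASP) : exists chi : int, forall a b : int,
  (asp_s alpha a b)%:Z = (asp_s (asp_flip alpha) (- a) (- b))%:Z + a - b + chi.
Proof.
pose D (a b : int) : int :=
  (asp_s alpha a b)%:Z - (asp_s (asp_flip alpha) (- a) (- b))%:Z - a + b.
have Dr (a b : int) : D a (b + 1) = D a b.
  rewrite /D (asp_s_stepr alpha a b).
  have := asp_s_stepr (asp_flip alpha) (- a) (- (b + 1)).
  rewrite (_ : - (b + 1) + 1 = - b) /=; last by lia.
  rewrite (_ : - 1 - - (b + 1) = b); last by lia.
  by move=> ->; lia.
have Dl (a b : int) : D (a + 1) b = D a b.
  rewrite /D (asp_s_stepl alpha a b).
  have := asp_s_stepl (asp_flip alpha) (- (a + 1)) (- b).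
  rewrite asp_flipV (_ : - (a + 1) + 1 = - a) /=; last by lia.
  rewrite (_ : - 1 - - (a + 1) = a); last by lia.
  by move=> ->; lia.
have cst (g : int -> int) : (forall n : int, g (n + 1) = g n) -> forall n : int, g n = g 0.
  move=> hg n; have [n0|n0] := leP 0 n.
    rewrite (_ : n = (absz n)%:Z); last by lia.
    elim: (absz n) => // k IH.
    by rewrite (_ : k.+1%:Z = k%:Z + 1); [rewrite hg | lia].
  rewrite (_ : n = - (absz n)%:Z); last by lia.
  elim: (absz n) => [|k IH]; first by rewrite oppr0.
  by rewrite -(hg (- k.+1%:Z)) (_ : - k.+1%:Z + 1 = - k%:Z); last lia.
exists (D 0 0) => a b.
have e1 := cst (fun b => D a b) (Dr a) b.
have e2 := cst (fun a => D a 0) (fun a => Dl a 0) a.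
by move: e1 e2 => /=; rewrite {1}/D; lia.
Qed.

Lemma int_threshold (P : int -> bool) : (forall a : int, P a -> P (a + 1)) ->
  (exists a : int, ~~ P a) -> (exists a : int, P a) -> exists c : int, forall a : int, P a = (c < a).
Proof.
move=> Ps [a0 na0] [a1 Pa1].
have Pm (a b : int) : a <= b -> P a -> P b.
  move=> ab Pa; rewrite (_ : b = a + (absz (b - a))%:Z); last by lia.
  elim: (absz _) => [|k IH]; first by rewrite addr0.
  by rewrite (_ : a + k.+1%:Z = a + k%:Z + 1); [apply: Ps | lia].
have lt01 : a0 < a1 by rewrite ltNge; apply: contra na0 => h; exact: Pm Pa1.
have exP : exists k : nat, P (a0 + k%:Z).
  by exists (absz (a1 - a0)); rewrite (_ : a0 + _ = a1) //; lia.
case: (ex_minnP exP) => k Pk kmin.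
exists (a0 + k%:Z - 1) => a; apply/idP/idP => [Pa|h]; last first.
  by apply: Pm Pk; lia.
have [h|//] := leP a (a0 + k%:Z - 1).
have a0a : a0 < a by rewrite ltNge; apply: contra na0 => h'; exact: Pm Pa.
have := kmin (absz (a - a0)).
rewrite (_ : a0 + _ = a); last by lia.
by move=> /(_ Pa); lia.
Qed.

Lemma asp_of_s (f : int -> int -> nat) (chi : int) :
  (forall a b : int, (f a (b + 1)%R <= f a b <= (f a (b + 1)%R).+1)%N) ->
  (forall a b : int, (f a b <= f (a + 1)%R b <= (f a b).+1)%N) ->
  (forall a b : int, (f a b + f (a + 1)%R (b + 1)%R <=
                f (a + 1)%R b + f a (b + 1)%R)%N) ->
  (forall a : int, exists B : int, forall b : int, B <= b -> f a b = 0%N) ->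
  (forall b : int, exists A : int, forall a : int, a <= A -> f a b = 0%N) ->
  (forall a : int, exists B : int, forall b : int, b <= B -> (f a b)%:Z = a - b + chi) ->
  (forall b : int, exists A : int, forall a : int, A <= a -> (f a b)%:Z = a - b + chi) ->
  exists gamma : ASP, forall a b, asp_s gamma a b = f a b.
Proof.
move=> Hr Hl Hm V1 V2 V3 V4.
have /choice [g hg] : forall b : int, exists c : int, forall a : int,
    (f a (b + 1)%R < f a b)%N = (c < a).
  move=> b; apply: int_threshold.
  - by move=> a; have := Hm a b; have := Hr (a + 1) b; lia.
  - have [A hA] := V2 b; exists A; rewrite (hA A) //.
  - have [A hA] := V4 b; have [A' hA'] := V4 (b + 1).
    exists (A + `|A' - A|).
    by have := hA (A + `|A' - A|); have := hA' (A + `|A' - A|); lia.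
have /choice [h hh] : forall a : int, exists c : int, forall b : int,
    (f (a + 1)%R b <= f a b)%N = (c < b).
  move=> a; apply: int_threshold.
  - by move=> b; have := Hm a b; have := Hl a b; lia.
  - have [B hB] := V3 a; have [B' hB'] := V3 (a + 1).
    exists (B - `|B' - B|).
    by have := hB (B - `|B' - B|); have := hB' (B - `|B' - B|); lia.
  - have [B hB] := V1 (a + 1); exists B; rewrite (hB B) //.
have key (a b : int) : (g b == a) = (h a == b).
  have := hg b a; have := hg b (a + 1); have := hh a b; have := hh a (b + 1).
  have := Hr a b; have := Hr (a + 1) b; have := Hl a b; have := Hl a (b + 1).
  by lia.
have gK : cancel g h by move=> b; apply/eqP; rewrite -key.
have hK : cancel h g by move=> a; apply/eqP; rewrite key.
have gfin : finite_set [set n : int | (n < 0) != (g n < 0)].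
  have [B hB] := V1 0; have [B' hB'] := V3 0.
  apply: sub_finite_set (finite_int_range (- `|B'| - 1) (`|B| + 1)) => n /=.
  rewrite negb_eqb => hn.
  have := hg n 0.
  have [h1|h1] := leP (`|B| + 1) n.
    by have := hB n; have := hB (n + 1); lia.
  have [h2|h2] := ltP n (- `|B'| - 1); last by lia.
  by have := hB' n; have := hB' (n + 1); lia.
pose gamma := MkASP (Bijective gK hK) gfin.
exists gamma => a b.
have [B hB] := V1 a; have [B' hB'] := asp_s_vanr gamma a.
pose c : int := `|B| + `|B'| + `|b|.
rewrite (_ : b = c - (absz (c - b))%:Z); last by lia.
elim: (absz _) => [|k IH].
  by rewrite subr0 hB ?hB' //; rewrite /c; lia.
have := asp_s_stepr gamma a (c - k.+1%:Z).
have := hg (c - k.+1%:Z) a.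
have := Hr a (c - k.+1%:Z).
rewrite (_ : c - k.+1%:Z + 1 = c - k%:Z) /=; last by lia.
by rewrite IH; lia.
Qed.

(* The equation [s_gamma (a, b) = min_l (s_alpha (a, l) + s_beta (l, b))], with
   "min" read as: an attained lower bound. *)
Definition is_demazure (alpha beta gamma : ASP) : Prop :=
  forall a b : int,
    (exists l : int, asp_s gamma a b = (asp_s alpha a l + asp_s beta l b)%N) /\
    (forall l : int, (asp_s gamma a b <= asp_s alpha a l + asp_s beta l b)%N).

Lemma is_demazure_ex (alpha beta : ASP) :
  exists gamma : ASP, is_demazure alpha beta gamma.
Proof.
have /choice [F hF] : forall p : int * int, exists m : nat,
    (exists l : int, m = (asp_s alpha p.1 l + asp_s beta l p.2)%N) /\
    (forall l : int, (m <= asp_s alpha p.1 l + asp_s beta l p.2)%N).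
  move=> [a b] /=.
  have ex : exists m : nat,
      `[< exists l : int, m = (asp_s alpha a l + asp_s beta l b)%N >].
    by exists (asp_s alpha a 0 + asp_s beta 0 b)%N; apply/asboolP; exists 0.
  case: (ex_minnP ex) => m /asboolP hm mmin; exists m; split=> // l.
  by apply: mmin; apply/asboolP; exists l.
pose f (a b : int) : nat := F (a, b).
have fex (a b : int) : exists l : int, f a b = (asp_s alpha a l + asp_s beta l b)%N.
  by have [] := hF (a, b).
have fle (a b l : int) : (f a b <= asp_s alpha a l + asp_s beta l b)%N.
  by have [_] := hF (a, b); apply.
have [ca hca] := asp_s_flip alpha; have [cb hcb] := asp_s_flip beta.
have flo (a b : int) : a - b + (ca + cb) <= (f a b)%:Z.
  have [l ->] := fex a b; have := hca a l; have := hcb l b; lia.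
have [gamma hg] : exists gamma : ASP, forall a b, asp_s gamma a b = f a b.
  apply: (@asp_of_s f (ca + cb)).
  - move=> a b; apply/andP; split.
      have [l ->] := fex a b; have := fle a (b + 1) l.
      by have := asp_s_stepr beta l b; lia.
    have [l ->] := fex a (b + 1); have := fle a b l.
    by have := asp_s_stepr beta l b; lia.
  - move=> a b; apply/andP; split.
      have [l ->] := fex (a + 1) b; have := fle a b l.
      by have := asp_s_stepl alpha a l; lia.
    have [l ->] := fex a b; have := fle (a + 1) b l.
    by have := asp_s_stepl alpha a l; lia.
  - move=> a b.
    have [l el] := fex (a + 1) b; have [k ek] := fex a (b + 1).
    have [lk|kl] := leP l k.
      have := fle a b l; have := fle (a + 1) (b + 1) k.
      by have := asp_s_stepl alpha a l; have := asp_s_stepl alpha a k; lia.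
    have := fle a b k; have := fle (a + 1) (b + 1) l.
    by have := asp_s_stepr beta l b; have := asp_s_stepr beta k b; lia.
  - move=> a; have [L hL] := asp_s_vanr alpha a.
    have [B hB] := asp_s_vanr beta L; exists B => b /hB.
    by have := fle a b L; rewrite (hL L) //; lia.
  - move=> b; have [L hL] := asp_s_vanl beta b.
    have [A hA] := asp_s_vanl alpha L; exists A => a /hA.
    by have := fle a b L; rewrite (hL L) //; lia.
  - move=> a; have [L hL] := asp_s_vanr (asp_flip alpha) (- a).
    have [B hB] := asp_s_vanr (asp_flip beta) L; exists (- B) => b hb.
    have := hB (- b); have := hL L; have := hca a (- L); have := hcb (- L) b.
    by have := fle a b (- L); have := flo a b; rewrite opprK; lia.
  - move=> b; have [L hL] := asp_s_vanl (asp_flip beta) (- b).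
    have [A hA] := asp_s_vanl (asp_flip alpha) L; exists (- A) => a ha.
    have := hA (- a); have := hL L; have := hca a (- L); have := hcb (- L) b.
    by have := fle a b (- L); have := flo a b; rewrite opprK; lia.
exists gamma => a b; rewrite hg; split; first exact: fex.
exact: fle.
Qed.

Lemma asp_s_inj (alpha beta : ASP) :
  (forall a b, asp_s alpha a b = asp_s beta a b) -> alpha = beta.
Proof.
move=> h; apply: aspP => n.
have e (a : int) : (alpha n < a) = (beta n < a).
  have := asp_s_stepr alpha a n; have := asp_s_stepr beta a n.
  by rewrite !h; lia.
by have := e (alpha n); have := e (beta n); lia.
Qed.

Lemma is_demazure_uniq (alpha beta gamma delta : ASP) :
  is_demazure alpha beta gamma -> is_demazure alpha beta delta -> gamma = delta.
Proof.
move=> hg hd; apply: asp_s_inj => a b; apply/eqP; rewrite eqn_leq.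
have [[l el] lg] := hg a b; have [[k ek] ld] := hd a b.
by rewrite {1}ek lg el ld.
Qed.

Definition demazure (alpha beta : ASP) : ASP :=
  sval (cid (is_demazure_ex alpha beta)).

Lemma demazureP (alpha beta : ASP) : is_demazure alpha beta (demazure alpha beta).
Proof. exact: svalP. Qed.

(* Main.v *)
Require Import Defs.
From mathcomp Require Import all_boot all_order all_algebra.
From mathcomp Require Import finmap zify boolp.
From mathcomp Require Import classical_sets cardinality.

(** Substituting [m = beta n] in the definition of [asp_s (alpha * beta) a b]
    turns it into the number of [m] with [alpha m < a] and
    [b <= beta^-1 m].  Cut the integers at an arbitrary [l].  Then
    [asp_s alpha a l] counts the same [m >= l] and also those with
    [beta^-1 m < b], and [asp_s beta l b] counts the same [m < l] and also those
    with [a <= alpha m].  So [asp_s alpha a l + asp_s beta l b] exceeds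
    [asp_s (alpha * beta) a b] by the number of elements of [low a b] (both
    images small) that are at least [l], plus the number of elements of
    [high a b] (both images large) that are below [l]: this is
    [asp_s_mul_excess].

    The excess is nonnegative, which gives the Bruhat inequality.  Equality
    holds exactly when, for all [a] and [b], some cut [l] separates [low a b],
    on its left, from [high a b], on its right.  Points [u] of [high a b] and
    [v] of [low a b] with [u < v] form a common inversion of [alpha] and
    [beta^-1].  Conversely, a common inversion [(u, v)] puts [u] in [high a b]
    and [v] in [low a b] for [a = alpha u], [b = beta^-1 u], and then no cut
    separates them.  Without common inversions a cut exists because
    [low a b] is bounded above and [high a b] is bounded below. *)

Set Implicit Arguments.
Unset Strict Implicit.
Unset Printing Implicit Defensive.

Import Order.TTheory.
Local Open Scope classical_set_scope.
Local Open Scope ring_scope.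

(** * Cardinals of finite sets of integers *)

Lemma card_fset_set_split (X Y : set int) : finite_set X ->
  #|` fset_set X| = (#|` fset_set (X `&` Y)| + #|` fset_set (X `\` Y)|)%N.
Proof.
move=> fX.
have fI : finite_set (X `&` Y) by apply: sub_finite_set fX => x [].
have fD : finite_set (X `\` Y) by apply: sub_finite_set fX => x [].
rewrite -{1}(setUIDK X Y) fset_setU // cardfsU -fset_setI //.
rewrite (_ : X `&` Y `&` (X `\` Y) = set0) ?fset_set0 ?cardfs0 ?subn0 //.
by apply/seteqP; split=> x //= [[_ Yx] [_ /(_ Yx)]].
Qed.

Lemma card_fset_set_image (f : int -> int) (X : set int) :
  injective f -> finite_set X -> #|` fset_set (f @` X)| = #|` fset_set X|.
Proof.
by move=> finj fX; rewrite fset_set_image // card_imfset.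
Qed.

Lemma card_fset_set_eq0 (X : set int) :
  finite_set X -> #|` fset_set X| = 0%N -> X = set0.
Proof.
by move=> fX /eqP; rewrite cardfs_eq0 => /eqP /fset_set_set0 ->.
Qed.

(** * The excess of a cut over the product *)

Section Cut.
Variables alpha beta : ASP.

Definition low (a b : int) : set int :=
  [set m | alpha m < a /\ asp_inv beta m < b].

Definition high (a b : int) : set int :=
  [set m | a <= alpha m /\ b <= asp_inv beta m].

(** The substitution [m = beta n], which makes the counts for [beta] and for
    the product range over the same variable as the count for [alpha]. *)
Lemma image_asp_inv (P : int -> int -> Prop) :
  beta @` [set n | P n (beta n)] = [set m | P (asp_inv beta m) m].
Proof.
apply/seteqP; split=> m /=; first by case=> n Pn <-; rewrite asp_funK.
by move=> Pm; exists (asp_invfun beta m); rewrite /= asp_invfunK.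
Qed.

Lemma asp_s_inv (l b : int) :
  asp_s beta l b = #|` fset_set [set m | b <= asp_inv beta m /\ m < l]|.
Proof.
rewrite -(image_asp_inv (fun n m => b <= n /\ m < l)).
by rewrite card_fset_set_image //; [exact: bij_inj (asp_bij beta)
                                   | exact: finite_asp_set].
Qed.

Lemma finite_asp_inv_set (b l : int) :
  finite_set [set m | b <= asp_inv beta m /\ m < l].
Proof.
rewrite -(image_asp_inv (fun n m => b <= n /\ m < l)).
exact: finite_image (finite_asp_set beta l b).
Qed.

Lemma finite_product_set (a b : int) :
  finite_set [set m | b <= asp_inv beta m /\ alpha m < a].
Proof.
rewrite -(image_asp_inv (fun n m => b <= n /\ alpha m < a)).
exact: finite_image (finite_asp_set (asp_mul alpha beta) a b).
Qed.

Lemma asp_s_mul (a b : int) :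
  asp_s (asp_mul alpha beta) a b =
  #|` fset_set [set m | b <= asp_inv beta m /\ alpha m < a]|.
Proof.
rewrite -(image_asp_inv (fun n m => b <= n /\ alpha m < a)).
by rewrite card_fset_set_image //; [exact: bij_inj (asp_bij beta)
                     | exact: (finite_asp_set (asp_mul alpha beta))].
Qed.

Lemma finite_low_cut (a b l : int) :
  finite_set (low a b `&` [set m | l <= m]).
Proof.
by apply: sub_finite_set (finite_asp_set alpha a l) => m /= [[? _] ?].
Qed.

Lemma finite_high_cut (a b l : int) :
  finite_set (high a b `&` [set m | m < l]).
Proof.
by apply: sub_finite_set (finite_asp_inv_set b l) => m /= [[_ ?] ?].
Qed.

(** Each of the three counts is split in two, according to the side of [l], [b]
    or [a] on which its unconstrained coordinate lies: the two parts of the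
    product count occur one in each summand, and what is left is the excess. *)
Lemma asp_s_mul_excess (a b l : int) :
  (asp_s alpha a l + asp_s beta l b =
   asp_s (asp_mul alpha beta) a b +
     (#|` fset_set (low a b `&` [set m | l <= m]%R)| +
      #|` fset_set (high a b `&` [set m | m < l]%R)|))%N.
Proof.
rewrite asp_s_mul asp_s_inv /asp_s.
rewrite (card_fset_set_split [set m | asp_inv beta m < b]
           (finite_asp_set alpha a l)).
rewrite (card_fset_set_split [set m | a <= alpha m] (finite_asp_inv_set b l)).
rewrite (card_fset_set_split [set m | l <= m] (finite_product_set a b)).
rewrite (_ : [set n | l <= n /\ alpha n < a] `&` [set m | asp_inv beta m < b]
           = low a b `&` [set m | l <= m]); last first.
  by apply/seteqP; split=> m /=; rewrite /low /=; tauto.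
rewrite (_ : [set m | b <= asp_inv beta m /\ m < l] `&` [set m | a <= alpha m]
           = high a b `&` [set m | m < l]); last first.
  by apply/seteqP; split=> m /=; rewrite /high /=; tauto.
rewrite (_ : [set n | l <= n /\ alpha n < a] `\` [set m | asp_inv beta m < b]
           = [set m | b <= asp_inv beta m /\ alpha m < a] `&` [set m | l <= m]);
  last by apply/seteqP; split=> m /=; lia.
rewrite (_ : [set m | b <= asp_inv beta m /\ m < l] `\` [set m | a <= alpha m]
           = [set m | b <= asp_inv beta m /\ alpha m < a] `\` [set m | l <= m]);
  last by apply/seteqP; split=> m /=; lia.
lia.
Qed.

(** * Separating cuts *)

Definition separates (l a b : int) : Prop :=
  (forall m, low a b m -> m < l) /\ (forall m, high a b m -> l <= m).

Lemma separatesP (l a b : int) :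
  separates l a b <->
  (asp_s (asp_mul alpha beta) a b = asp_s alpha a l + asp_s beta l b)%N.
Proof.
rewrite asp_s_mul_excess; split=> [[lo hi]|e].
  rewrite [low a b `&` _](_ : _ = set0); last first.
    by apply/seteqP; split=> m //= [/lo]; lia.
  rewrite [high a b `&` _](_ : _ = set0) ?fset_set0 ?cardfs0 ?addn0 //.
  by apply/seteqP; split=> m //= [/hi]; lia.
have /card_fset_set_eq0 : #|` fset_set (low a b `&` [set m | l <= m])| = 0%N.
  by lia.
move=> /(_ (finite_low_cut a b l)) lo.
have /card_fset_set_eq0 : #|` fset_set (high a b `&` [set m | m < l])| = 0%N.
  by lia.
move=> /(_ (finite_high_cut a b l)) hi.
split=> m hm.
  rewrite ltNge; apply/negP => ml.
  by have : (low a b `&` [set m | l <= m]) m; [split | rewrite lo].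
rewrite leNgt; apply/negP => ml.
by have : (high a b `&` [set m | m < l]) m; [split | rewrite hi].
Qed.

Lemma low_bounded (a b : int) : exists L : int, forall m, low a b m -> m < L.
Proof.
have [N hN] := finite_int_bound (finite_asp_set alpha a 0).
exists N%:Z => m [am _]; rewrite ltNge; apply/negP => Nm.
by have /hN : [set n : int | 0 <= n /\ alpha n < a] m; [split=> //; lia | lia].
Qed.

Lemma high_bounded (a b : int) : exists L : int, forall m, high a b m -> L <= m.
Proof.
have [N hN] := finite_int_bound (finite_asp_inv_set b 0).
exists (- N%:Z) => m [_ bm]; rewrite leNgt; apply/negP => Nm.
by have /hN : [set m | b <= asp_inv beta m /\ m < 0] m; [split=> //; lia | lia].
Qed.

(** The cut is placed just after the largest element of [low a b]; when
    [low a b] is empty, any lower bound of [high a b] is a cut. *)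
Lemma separates_ex (a b : int) :
  Inv alpha `&` Inv (asp_inv beta) = set0 -> exists l, separates l a b.
Proof.
move=> inv0.
have lowhigh u v : high a b u -> low a b v -> v < u.
  move=> [/= au bu] [/= av bv]; rewrite ltNge; apply/negP => uv.
  have nuv : u != v by apply: contraTneq au => ->; lia.
  have : (Inv alpha `&` Inv (asp_inv beta)) (u, v).
    by split; split=> /=; lia.
  by rewrite inv0.
have [le0|nle0] := pselect (low a b = set0).
  have [L hL] := high_bounded a b.
  by exists L; split=> // m; rewrite le0.
have /set0P [v lv] : low a b != set0 by apply/eqP.
have [c hc] : exists c : int, forall l : int,
    `[< forall m, low a b m -> m < l >] = (c < l).
  apply: int_threshold.
  - by move=> l /asboolP hl; apply/asboolP => m /hl; lia.
  - by exists v; apply/asboolPn => /(_ v lv); rewrite ltxx.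
  - by have [L hL] := low_bounded a b; exists L; apply/asboolP.
exists (c + 1); split.
  by apply/asboolP; rewrite hc; lia.
move=> u hu; have := hc u.
have -> : `[< forall m, low a b m -> m < u >] by apply/asboolP => m /(lowhigh _ _ hu).
lia.
Qed.

Lemma separates_Inv0 :
  (forall a b, exists l, separates l a b) ->
  Inv alpha `&` Inv (asp_inv beta) = set0.
Proof.
move=> sep; apply/seteqP; split=> // -[u v] [[/= uv auv] [_ /= buv]].
have [l [lo hi]] := sep (alpha u) (asp_inv beta u).
have : v < l by apply: lo.
have : l <= u by apply: hi; split.
lia.
Qed.

End Cut.

(** * Comparison of the two products *)

Lemma asp_mul_demazure_le (alpha beta : ASP) :
  bruhat_le (asp_mul alpha beta) (demazure alpha beta).
Proof.
move=> a b; have [[l ->] _] := demazureP alpha beta a b.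
by rewrite asp_s_mul_excess leq_addr.
Qed.

Lemma is_demazure_mulP (alpha beta : ASP) :
  is_demazure alpha beta (asp_mul alpha beta) <->
  (forall a b, exists l, separates alpha beta l a b).
Proof.
split=> [dem a b|sep a b].
  by have [[l el] _] := dem a b; exists l; apply/separatesP.
split=> [|l]; last by rewrite asp_s_mul_excess leq_addr.
by have [l /separatesP el] := sep a b; exists l.
Qed.

Theorem lemma5p1 (alpha beta : ASP) :
  bruhat_le (alpha * beta)%g (demazure alpha beta) /\
  (demazure alpha beta = (alpha * beta)%g <->
   (Inv alpha `&` Inv (beta^-1)%g = set0)%classic).
Proof.
split; first exact: asp_mul_demazure_le.
split=> [e|inv0].
  apply/separates_Inv0/is_demazure_mulP.
  by rewrite -[asp_mul _ _]e; exact: demazureP.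
apply: is_demazure_uniq (demazureP alpha beta) _.
by apply/is_demazure_mulP => a b; exact: separates_ex.
Qed.
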